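(* Let $m\ge2$ be an integer and $L>0$. Let $\mathcal{M}$ be either the isotonic function class or the Lipschitz monotonic function class $\mathcal{M}(1)$ (both defined in the context), and consider the Lipschitz smooth tensor class with extra monotonicity $$\mathcal{P}_M=\{\Theta\in\mathbb{R}^{d\times\cdots\times d}:\ \Theta(i_1,\dots,i_m)=f(i_1/d,\dots,i_m/d)\ \text{for all }(i_1,\dots,i_m)\in[d]^m,\ f\in\mathcal{F}(1,L)\cap\mathcal{M}\}.$$ Then the estimation problem based on the Gaussian model $\mathcal{Y}=\Theta\circ\pi+\mathcal{E}$, with $\mathcal{E}$ having i.i.d. $N(0,1)$ entries, obeys the minimax lower bound $$\inf_{(\hat\Theta,\hat\pi)}\ \sup_{\Theta\in\mathcal{P}_M,\ \pi\in\Pi(d,d)}\ \mathbb{P}\Big(\mathrm{MSE}(\hat\Theta\circ\hat\pi,\ \Theta\circ\pi)\gtrsim \mathrm{Rate}(d)/\log d\Big)\ \ge\ 0.8,$$ where $\mathrm{Rate}(d)=d^{-\frac{2m}{m+2}}\vee d^{-(m-1)}\log d$ and the infimum is over all estimators $(\hat\Theta,\hat\pi)$ based on $\mathcal{Y}$.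
   Context: Notation: $[d]=\{1,\dots,d\}$; $\Pi(d,d)$ is the set of permutations of $[d]$; $a\vee b=\max(a,b)$; $\|\cdot\|_F$ is the Frobenius norm. For $\Theta\in\mathbb{R}^{d\times\cdots\times d}$ (order $m$) and $\pi\in\Pi(d,d)$, $(\Theta\circ\pi)(i_1,\dots,i_m)=\Theta(\pi(i_1),\dots,\pi(i_m))$. $\mathrm{MSE}(\Theta_1,\Theta_2)=d^{-m}\|\Theta_1-\Theta_2\|_F^2$. $\mathcal{F}(1,L)$ is the set of $f:[0,1]^m\to\mathbb{R}$ with $|f(x)-f(x_0)|\le L\|x-x_0\|_\infty$ for all $x,x_0\in[0,1]^m$. Isotonic class: $\{f:[0,1]^m\to\mathbb{R}\ |\ f(x_1,\dots,x_m)\le f(x_1',\dots,x_m')\text{ whenever }x_i\le x_i'\text{ for all }i\in[m]\}$. Lipschitz monotonic class $\mathcal{M}(1)$: the set of $f:[0,1]^m\to\mathbb{R}$ such that for all $d$, $\frac{i-j}{d}\lesssim g(i)-g(j)$ for all $j\le i\in[d]$ (with a constant not depending on $d,i,j$), where $g(i)=d^{-(m-1)}\sum_{(i_2,\dots,i_m)\in[d]^{m-1}}f(i/d,i_2/d,\dots,i_m/d)$. Convention: the symbol $\gtrsim$ inside the probability means ''$\ge c\,\cdot$'' for some constant $c>0$ that does not depend on $d$, the statement being asymptotic, i.e. for $d$ sufficiently large. *)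

(* Defs.v *)
From HB Require Import structures.
From mathcomp Require Import all_boot all_order all_algebra all_fingroup.
From mathcomp Require Import all_classical all_reals all_analysis.

Set Implicit Arguments.
Unset Strict Implicit.
Unset Printing Implicit Defensive.

Import Order.TTheory GRing.Theory Num.Theory.
Import numFieldNormedType.Exports.

Local Open Scope classical_set_scope.
Local Open Scope ring_scope.

(* The multi-indices (i_1, ..., i_m) of [d]^m, shifted so that the ordinal i
   stands for i + 1. *)
Notation mindex m d := (m.-tuple 'I_d).

Definition tensor (R : realType) (m d : nat) : Type := {ffun mindex m d -> R}.

Definition tensor_entry (R : realType) (m d : nat) (k : mindex m d)
  (Y : tensor R m d) : R := Y k.

Section tensor_instances.
Context (R : realType) (m d : nat).

HB.instance Definition _ := GRing.Zmodule.on (tensor R m d).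
HB.instance Definition _ := isPointed.Build (tensor R m d) 0.

Definition tensor_sigma : set (set (tensor R m d)) :=
  <<s \bigcup_(k : mindex m d)
        preimage_set_system setT (@tensor_entry R m d k) measurable >>.

Let tensor_set0 : tensor_sigma set0.
Proof. exact: sigma_algebra0. Qed.

Let tensor_setC A : tensor_sigma A -> tensor_sigma (~` A).
Proof. exact: sigma_algebraC. Qed.

Let tensor_bigcup (F : (set (tensor R m d))^nat) :
  (forall i, tensor_sigma (F i)) -> tensor_sigma (\bigcup_i F i).
Proof. exact: sigma_algebra_bigcup. Qed.

(* The product sigma-algebra on R^(d x ... x d). *)
HB.instance Definition _ := @isMeasurable.Build default_measure_display
  (tensor R m d) tensor_sigma tensor_set0 tensor_setC tensor_bigcup.

End tensor_instances.

Section tensors.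
Context (R : realType) (m d : nat).
Implicit Types (Theta : tensor R m d) (pi : {perm 'I_d}).

Definition tensor_perm Theta pi : tensor R m d :=
  [ffun k : mindex m d => Theta (map_tuple pi k)].

Definition frobenius Theta : R :=
  Num.sqrt (\sum_(k : mindex m d) Theta k ^+ 2).

Definition MSE (Theta1 Theta2 : tensor R m d) : R :=
  (d%:R ^+ m)^-1 * frobenius (Theta1 - Theta2) ^+ 2.

Definition grid (k : mindex m d) : 'rV[R]_m :=
  \row_(q < m) ((tnth k q).+1%:R / d%:R).

End tensors.

Arguments grid {R m d} k.

(* Functions [0,1]^m -> R are represented by total functions on 'rV[R]_m that
   are only constrained, and only evaluated, on the cube. *)
Section function_classes.
Context (R : realType) (m : nat).
Implicit Types f : 'rV[R]_m -> R.

Definition cube : set 'rV[R]_m := [set x | forall q, 0 <= x ord0 q <= 1].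

(* The norm of 'rV[R]_m is the sup norm. *)
Definition lipschitz_class (L : R) : set ('rV[R]_m -> R) :=
  [set f | forall x x0, cube x -> cube x0 -> `|f x - f x0| <= L * `|x - x0|].

Definition isotonic_class : set ('rV[R]_m -> R) :=
  [set f | forall x x', cube x -> cube x' ->
     (forall q, x ord0 q <= x' ord0 q) -> f x <= f x'].

(* The sum ranges over the multi-indices whose first component is i. *)
Definition slice_mean f (d : nat) (i : 'I_d) : R :=
  (d%:R ^+ m.-1)^-1 * \sum_(k : mindex m d | ohead k == Some i) f (grid k).

(* The constant C may depend on f, but not on d, i, j. *)
Definition lip_monotonic_class : set ('rV[R]_m -> R) :=
  [set f | exists2 C : R, 0 < C &
     forall (d : nat) (i j : 'I_d), (j <= i)%N ->
       (i%:R - j%:R) / d%:R <= C * (slice_mean f i - slice_mean f j)].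

Definition smooth_tensors (L : R) (M : set ('rV[R]_m -> R)) (d : nat) :
    set (tensor R m d) :=
  [set Theta | exists2 f, (lipschitz_class L `&` M) f &
     forall k, Theta k = f (grid k)].

Definition rate (d : nat) : R :=
  Num.max (d%:R `^ (- (2 * m%:R / (m%:R + 2)))) (d%:R ^- m.-1 * ln d%:R).

End function_classes.

Section gaussian_model.
Context (R : realType) (m d : nat).
Context (d0 : measure_display) (Omega : measurableType d0)
  (P : probability Omega R).

Definition mutually_independent (I : finType) (X : I -> {RV P >-> R}) : Prop :=
  forall (J : {set I}) (B : I -> set R), (forall k, measurable (B k)) ->
    P (\bigcap_(k in [set` J]) X k @^-1` B k) =
    (\prod_(k in J) P (X k @^-1` B k))%E.

Definition iid_std_normal (I : finType) (X : I -> {RV P >-> R}) : Prop :=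
  mutually_independent X /\
  forall (k : I) (B : set R), measurable B ->
    distribution P (X k) B = normal_prob 0 1 B.

Definition observation (E : mindex m d -> {RV P >-> R})
    (Theta : tensor R m d) (pi : {perm 'I_d}) (w : Omega) : tensor R m d :=
  tensor_perm Theta pi + [ffun k => E k w].

Definition estimators :
    set ((tensor R m d -> tensor R m d) * (tensor R m d -> {perm 'I_d})) :=
  [set e | measurable_fun setT e.1 /\
     forall s : {perm 'I_d}, measurable (e.2 @^-1` [set s])].

(* The minimax probability that the MSE is at least t, over the parameters
   (Theta, pi), with Theta in S and pi any permutation. *)
Definition minimax_prob (E : mindex m d -> {RV P >-> R})
    (S : set (tensor R m d)) (t : R) : \bar R :=
  ereal_inf [set
    ereal_sup [set
      P [set w | t <= MSE (tensor_perm (e.1 (observation E Theta pi w))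
                                       (e.2 (observation E Theta pi w)))
                          (tensor_perm Theta pi)]
      | Theta in S & pi in [set: {perm 'I_d}]]
    | e in estimators].

End gaussian_model.

(* Main.v *)
From HB Require Import structures.
Require Import Defs.
From mathcomp Require Import all_boot all_order all_algebra all_fingroup.
From mathcomp Require Import all_classical all_reals all_analysis.
From mathcomp Require Import ring lra zify measurable_realfun.
Import Order.TTheory GRing.Theory Num.Theory.
Import numFieldNormedType.Exports.
Local Open Scope classical_set_scope.
Local Open Scope ring_scope.

(* For m >= 2 the quantity Rate(d) / log d is at most d^(-2m/(m+2)), so only the
   nonparametric part of the rate matters and the unknown permutation can be
   taken to be the identity.  Put a small tent on each block of a regular
   partition of the cube into N blocks of side of order d^(-m/(m+2)), and add
   any subset s of these tents to a linear ramp that is steep enough to make the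
   sum monotone.  Two such functions differ by an energy proportional to the
   Hamming distance of the subsets, while all of them are at squared distance at
   most N/16 from the bare ramp.  The events {estimate close to Theta_s} overlap
   at most (8/5)^N times among the 2^N subsets s, hence some of them have
   probability at most (4/5)^N under the bare ramp; a second moment bound on the
   Gaussian likelihood ratio costs a factor of order e^(N/16) when passing to
   Theta_s, and e^(1/16) * 4/5 < 1. *)

(** * Weighted laws *)

Section density.
Context {R : realType}.
Import HBNNSimple.

(* The integral of phi(X) G is the limit of the integrals of the simple
   approximations of phi, which only involve the weighted law C |-> E[1_C(X) G];
   hence two weighted laws that agree on sets agree on functions. *)
Lemma integral_comp_weight_limit {d1 : measure_display} {T : measurableType d1}
    (mu : {measure set T -> \bar R}) (X G : T -> R) (phi : R -> R)
    (mX : measurable_fun setT X) (mG : measurable_fun setT G)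
    (G0 : forall t, 0 <= G t) (mphi : measurable_fun setT phi)
    (phi0 : forall x, 0 <= phi x) :
  let f := nnsfun_approx measurableT
             ((measurable_EFinP setT phi).2 mphi) in
  (\int[mu]_t (phi (X t) * G t)%:E)%E =
  limn (fun n => \sum_(r \in range (f n))
      (r%:E * \int[mu]_t (\1_(f n @^-1` [set r]) (X t) * G t)%:E)%E)%E.
Proof.
move=> f.
have mfX n : measurable_fun setT (fun t => f n (X t)).
  by apply: (measurableT_comp _ mX); exact: measurable_funPT.
transitivity (limn (fun n => \int[mu]_t (f n (X t) * G t)%:E))%E.
  rewrite -monotone_convergence//.
  - apply: eq_integral => t _; apply/esym/cvg_lim => //.
    under eq_fun do rewrite EFinM.
    rewrite EFinM; apply: cvgeZr => //.
    by apply: (@cvg_nnsfun_approx _ _ _ setT) => // x _; rewrite lee_fin.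
  - by move=> n; apply/measurable_EFinP/measurable_funM.
  - by move=> n t _; rewrite lee_fin mulr_ge0.
  - move=> t _ p q pq; rewrite lee_fin ler_wpM2r//.
    exact/lefP/nd_nnsfun_approx.
congr (lim (_ @ \oo)); apply/funext => n.
have mI r : measurable (f n @^-1` [set r]) by [].
have mIG r : measurable_fun setT (fun t => \1_(f n @^-1` [set r]) (X t) * G t).
  apply: measurable_funM => //.
  by apply: (measurableT_comp _ mX); exact: measurable_indic.
transitivity (\int[mu]_t \sum_(r \in range (f n))
    (r%:E * (\1_(f n @^-1` [set r]) (X t) * G t)%:E)%E)%E.
  apply: eq_integral => t _; rewrite fimfunE EFinM -fsumEFin//.
  rewrite ge0_mule_fsuml//; last first.
    by move=> r; rewrite lee_fin; exact: nnfun_muleindic_ge0.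
  by apply: eq_fsbigr => r _; rewrite -!EFinM mulrA.
have r0 r t : (0 <= r%:E * (\1_(f n @^-1` [set r]) (X t) * G t)%:E)%E.
  rewrite -EFinM lee_fin mulrA mulr_ge0//.
  by have := nnfun_muleindic_ge0 (f n) r (X t); rewrite lee_fin.
rewrite ge0_integral_fsum//; last first.
  by move=> r; apply/measurable_EFinP/measurable_funM.
apply: eq_fsbigr => r; rewrite inE => -[x _ <-].
rewrite ge0_integralZl_EFin//.
- by move=> t _; rewrite lee_fin mulr_ge0.
- exact/measurable_EFinP.
Qed.

Lemma eq_weighted_law {d1 d2 : measure_display} {T : measurableType d1}
    {S : measurableType d2}
    (mu : {measure set T -> \bar R}) (nu : {measure set S -> \bar R})
    (X G : T -> R) (Y H : S -> R) (phi : R -> R)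
    (mX : measurable_fun setT X) (mG : measurable_fun setT G)
    (mY : measurable_fun setT Y) (mH : measurable_fun setT H)
    (G0 : forall t, 0 <= G t) (H0 : forall s, 0 <= H s)
    (mphi : measurable_fun setT phi) (phi0 : forall x, 0 <= phi x) :
  (forall C, measurable C -> \int[mu]_t (\1_C (X t) * G t)%:E =
                             \int[nu]_s (\1_C (Y s) * H s)%:E)%E ->
  (\int[mu]_t (phi (X t) * G t)%:E = \int[nu]_s (phi (Y s) * H s)%:E)%E.
Proof.
move=> eqC.
rewrite (integral_comp_weight_limit mu X G phi mX mG G0 mphi phi0).
rewrite (integral_comp_weight_limit nu Y H phi mY mH H0 mphi phi0).
congr (lim (_ @ \oo)); apply/funext => n.
by apply: eq_fsbigr => r _; rewrite eqC.
Qed.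

End density.

(** * Standard normal variables and their likelihood ratios *)

Lemma integral_indic_rv {R : realType} {d0 : measure_display}
    {Omega : measurableType d0} (P : probability Omega R) (X : {RV P >-> R})
    (B : set R) : measurable B ->
  (\int[P]_w (\1_B (X w))%:E = P (X @^-1` B))%E.
Proof.
move=> mB; have mXB : measurable (X @^-1` B) by exact: measurable_funPTI.
rewrite -[X in P X]setIT -(integral_indic P measurableT mXB).
by apply: eq_integral => w _; rewrite !indicE.
Qed.

Section std_normal.
Context {R : realType}.

(** The density of N(t, 1) with respect to N(0, 1), at x. *)
Definition gauss_lr (t x : R) : R := expR (t * x - t ^+ 2 / 2).

Lemma measurable_gauss_lr (t : R) : measurable_fun setT (gauss_lr t).
Proof.
by apply: measurableT_comp => //; exact: measurable_funB.
Qed.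

Lemma gauss_lr_ge0 (t x : R) : 0 <= gauss_lr t x.
Proof. exact: expR_ge0. Qed.

Lemma gauss_lr_pdf (t x : R) :
  gauss_lr t x * normal_pdf 0 1 x = normal_pdf 0 1 (x - t).
Proof.
rewrite /normal_pdf (negbTE (oner_neq0 _)) mulrCA; congr (_ * _).
rewrite /gauss_lr /normal_fun -expRD; congr expR.
by rewrite !subr0 expr1n; field.
Qed.

(** Squaring doubles the shift, so the second moment under N(0, 1) is exp(t^2). *)
Lemma gauss_lr_sqr (t x : R) :
  gauss_lr t x ^+ 2 = expR (t ^+ 2) * gauss_lr (2 * t) x.
Proof. by rewrite /gauss_lr -expRM_natl -expRD; congr expR; field. Qed.

(** Uniqueness of Lebesgue measure: half-open intervals keep their length under translation. *)
Lemma lebesgue_measureD (t : R) (A : set R) : measurable A ->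
  pushforward lebesgue_measure (fun x : R => (x + t : measurableTypeR R)) A
  = lebesgue_measure A.
Proof.
move=> mA; apply/esym/lebesgue_measure_unique => //=.
  exact: measurable_funD.
move=> _ _ [[a b]] _ <-; rewrite /pushforward.
rewrite (_ : _ @^-1` _ = `]a - t, b - t]%classic); last first.
  apply/seteqP; split=> x /=; rewrite !in_itv/= => /andP[ax xb].
    by rewrite ltrBlDr lerBrDr ax xb.
  by rewrite -ltrBlDr -lerBrDr ax xb.
rewrite !lebesgue_measure_itv/= !lte_fin ltrBlDr subrK; case: ifPn => // _.
by rewrite -!EFinD; congr (_%:E); ring.
Qed.

Lemma integral_lebesgueD (t : R) (f : R -> \bar R) :
  measurable_fun setT f -> (forall x, 0 <= f x)%E ->
  (\int[@lebesgue_measure R]_x f (x + t)%R = \int[@lebesgue_measure R]_x f x)%E.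
Proof.
move=> mf f0; pose g := fun x : R => (x + t : measurableTypeR R).
have mg : measurable_fun setT g by exact: measurable_funD.
transitivity (\int[pushforward (@lebesgue_measure R) g]_x f x)%E.
  by rewrite ge0_integral_pushforward.
by apply: eq_measure_integral => A mA _; exact: lebesgue_measureD.
Qed.

Context {d0 : measure_display} {Omega : measurableType d0}.
Variables (P : probability Omega R) (X : {RV P >-> R}).
Hypothesis lawX : forall B : set R, measurable B ->
  distribution P X B = normal_prob 0 1 B.

Lemma integral_std_normal (phi : R -> R) :
  measurable_fun setT phi -> (forall x, 0 <= phi x) ->
  (\int[P]_w (phi (X w))%:E =
   \int[@lebesgue_measure R]_x (phi x * normal_pdf 0 1 x)%:E)%E.
Proof.
move=> mphi phi0; under eq_integral do rewrite -[phi _]mulr1.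
apply: (@eq_weighted_law R _ _ _ _ P lebesgue_measure X (cst 1) id
  (normal_pdf 0 1) phi) => //.
- exact: measurable_normal_pdf.
- exact: normal_pdf_ge0.
move=> C mC; under eq_integral do rewrite mulr1.
rewrite integral_indic_rv//.
have := lawX C mC; rewrite /distribution /pushforward => ->.
rewrite /normal_prob [LHS]integral_mkcond.
congr (integral _ _ _). apply/funext => x.
rewrite patchE indicE; case: ifPn => _; first by rewrite mul1r.
by rewrite mul0r.
Qed.

(** The weight turns the normal density at x into the one at x - t; translation invariance then
    moves the shift into the argument of [phi]. *)
Lemma integral_std_normal_lr (t : R) (phi : R -> R) :
  measurable_fun setT phi -> (forall x, 0 <= phi x) ->
  (\int[P]_w (phi (X w) * gauss_lr t (X w))%:E =
   \int[P]_w (phi (X w + t))%:E)%E.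
Proof.
move=> mphi phi0.
rewrite (integral_std_normal (fun x => phi x * gauss_lr t x)).
- rewrite (integral_std_normal (fun x => phi (x + t))) => //; last first.
    by apply: measurableT_comp => //; exact: measurable_funD.
  rewrite -[RHS](@integral_lebesgueD (- t)).
  + apply: eq_integral => x _; congr (_%:E).
    by rewrite subrK -gauss_lr_pdf mulrA.
  + apply/measurable_EFinP/measurable_funM.
      by apply: measurableT_comp => //; exact: measurable_funD.
    exact: measurable_normal_pdf.
  + by move=> x; rewrite lee_fin mulr_ge0// normal_pdf_ge0.
- by apply: measurable_funM => //; exact: measurable_gauss_lr.
- by move=> x; rewrite mulr_ge0// gauss_lr_ge0.
Qed.

End std_normal.

(** * Products over independent variables *)

Section independence.
Context {R : realType} {d0 : measure_display} {Omega : measurableType d0}.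
Variables (P : probability Omega R) (I : finType) (X : I -> {RV P >-> R}).
Hypothesis indX : mutually_independent X.

(** Induction on the list [s] of indices whose factor may be arbitrary, the others being indicators.
    For empty [s] this is the definition of independence. *)
Let integral_prod_except (s : seq I) : forall (psi : I -> R -> R) (a : I -> R),
  (forall k, measurable_fun setT (psi k)) -> (forall k x, 0 <= psi k x) ->
  (forall k, \int[P]_w (psi k (X k w))%:E = (a k)%:E)%E ->
  (forall k, k \notin s -> exists2 B, measurable B & psi k = \1_B) ->
  (\int[P]_w (\prod_k psi k (X k w))%:E = (\prod_k a k)%:E)%E.
Proof.
elim: s => [|k0 s IH] psi a mpsi psi0 ipsi psis.
  have {}psis k : exists B, measurable B /\ psi k = \1_B.
    by have [//|B mB ->] := psis k; exists B.
  have [B mB] := choice psis.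
  rewrite (_ : (\int[P]_w _)%E =
      P (\bigcap_(k in [set` [set: I]%SET]) X k @^-1` B k)); last first.
    rewrite -[X in P X]setIT -(integral_indic P measurableT); last first.
      apply: fin_bigcap_measurable => // k _.
      by apply: measurable_funPTI => //; exact: (mB k).1.
    apply: eq_integral => w _; congr (_%:E); rewrite indicE.
    have [wB|wB] := boolP (w \in _).
      move/set_mem : wB => wB; rewrite big1// => k _.
      by rewrite (mB k).2 indicE mem_set//; apply: wB; rewrite /= inE.
    move: wB; rewrite notin_setE => /existsNP[k /not_implyP[_ /= nB]].
    rewrite (bigD1 k)//= (mB k).2 indicE memNset ?mul0r//.
  rewrite indX; last by move=> k; exact: (mB k).1.
  rewrite -prodEFin; apply: eq_big => k; first by rewrite inE.
  move=> _; rewrite -ipsi (mB k).2 integral_indic_rv//; exact: (mB k).1.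
have a0 k : 0 <= a k.
  by rewrite -lee_fin -ipsi integral_ge0// => w _; rewrite lee_fin.
(* The factors other than that of [k0] are frozen into a weight [G]; it remains to see that [X k0]
   has the same weighted law under [G] as under the constant [c]. *)
pose G w := \prod_(k | k != k0) psi k (X k w).
have mG : measurable_fun setT G.
  rewrite /G; under eq_fun do rewrite -big_filter.
  apply: measurable_prod => k _.
  by apply: measurableT_comp => //; exact: measurable_funPT.
pose c := \prod_(k | k != k0) a k.
transitivity (\int[P]_w (psi k0 (X k0 w) * c)%:E)%E; last first.
  under eq_integral do rewrite mulrC EFinM.
  rewrite ge0_integralZl_EFin//.
  - by rewrite ipsi -EFinM (bigD1 k0)//= mulrC.
  - by move=> w _; rewrite lee_fin.
  - by apply/measurable_EFinP; apply: measurableT_comp.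
  - exact: prodr_ge0.
transitivity (\int[P]_w (psi k0 (X k0 w) * G w)%:E)%E.
  by apply: eq_integral => w _; rewrite (bigD1 k0).
apply: eq_weighted_law => //.
- by move=> w; exact: prodr_ge0.
- by move=> w; exact: prodr_ge0.
move=> C mC.
(* With an indicator at [k0], this index can leave the list and the induction hypothesis applies. *)
pose psi' k := if k == k0 then \1_C : R -> R else psi k.
have iC : (\int[P]_w (\1_C (X k0 w))%:E = (fine (P (X k0 @^-1` C)))%:E)%E.
  rewrite integral_indic_rv// fineK// fin_num_measure//.
  exact: measurable_funPTI.
pose a' k := if k == k0 then fine (P (X k0 @^-1` C)) else a k.
transitivity (\prod_k a' k)%:E.
  rewrite -(IH psi' a').
  - apply: eq_integral => w _; congr (_%:E).
    rewrite [RHS](bigD1 k0)//= /psi' eqxx; congr (_ * _).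
    by apply: eq_bigr => k /negbTE ->.
  - by move=> k; rewrite /psi'; case: ifPn => // _; exact: measurable_indic.
  - by move=> k x; rewrite /psi'; case: ifPn.
  - by move=> k; rewrite /psi' /a'; case: eqP => [->|].
  - move=> k ks; rewrite /psi'; case: eqVneq => [_|kk0]; first by exists C.
    by apply: psis; rewrite inE negb_or kk0.
under eq_integral do rewrite mulrC EFinM.
rewrite ge0_integralZl_EFin//.
- rewrite iC -EFinM (bigD1 k0)//= {1}/a' eqxx mulrC; congr (_ * _)%:E.
  by apply: eq_bigr => k /negbTE kk0; rewrite /a' kk0.
- by apply/measurable_EFinP; apply: measurableT_comp.
- exact: prodr_ge0.
Qed.

Lemma integral_prod_independent (psi : I -> R -> R) (a : I -> R) :
  (forall k, measurable_fun setT (psi k)) -> (forall k x, 0 <= psi k x) ->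
  (forall k, \int[P]_w (psi k (X k w))%:E = (a k)%:E)%E ->
  (\int[P]_w (\prod_k psi k (X k w))%:E = (\prod_k a k)%:E)%E.
Proof.
move=> mpsi psi0 ipsi; apply: (integral_prod_except (enum I)) => // k.
by rewrite mem_enum.
Qed.

End independence.

(** * Gaussian shifts of random tensors *)

Section weighted_law.
Context {R : realType} {d1 d2 : measure_display}
  {T : measurableType d1} {S : measurableType d2}.
Variables (mu : {measure set T -> \bar R}) (f : T -> R) (Y : T -> S).
Hypotheses (mf : measurable_fun setT f) (f0 : forall t, 0 <= f t)
  (mY : measurable_fun setT Y).

(** The law of [Y] under the measure of density [f] with respect to [mu]. As a measure, it can be
    identified by its values on a pi-system. *)
Definition weighted_law (C : set S) : \bar R :=
  (\int[mu]_(t in Y @^-1` C) (f t)%:E)%E.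

Let weighted_law0 : weighted_law set0 = 0%E.
Proof. by rewrite /weighted_law preimage_set0 integral_set0. Qed.

Let weighted_law_ge0 C : (0 <= weighted_law C)%E.
Proof. by apply: integral_ge0 => t _; rewrite lee_fin. Qed.

Let weighted_law_sigma_additive : semi_sigma_additive weighted_law.
Proof.
move=> F mF tF mUF; rewrite /weighted_law preimage_bigcup.
rewrite ge0_integral_bigcup//=.
- by apply: is_cvg_ereal_nneg_natsum_cond => n _ _; exact: weighted_law_ge0.
- by move=> k; rewrite -[X in measurable X]setTI; exact: mY.
- by apply: measurable_funTS; exact/measurable_EFinP.
- by move=> t _; rewrite lee_fin.
- apply/trivIsetP => /= i j _ _ ij; rewrite -preimage_setI.
  by move/trivIsetP : tF => /(_ _ _ _ _ ij) ->//; rewrite preimage_set0.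
Qed.

HB.instance Definition _ := isMeasure.Build _ _ _
  weighted_law weighted_law0 weighted_law_ge0 weighted_law_sigma_additive.

End weighted_law.

(** * The product sigma-algebra on tensors *)

Section tensor_measurability.
Context {R : realType} {m d : nat}.

Lemma measurable_tensor_entry (k : mindex m d) :
  measurable_fun setT (fun y : tensor R m d => y k).
Proof.
move=> _ B mB; apply: sub_sigma_algebra; exists k => //.
by exists B.
Qed.

Lemma measurable_fun_tensor {d1 : measure_display} {T : measurableType d1}
    (f : T -> tensor R m d) :
  (forall k, measurable_fun setT (fun t => f t k)) -> measurable_fun setT f.
Proof.
move=> mf; apply: measurability => // _ [_ [k _ [B mB <-]] <-].
by rewrite setTI; have := mf k measurableT B mB; rewrite !setTI.
Qed.

Lemma measurable_tensorD (D : tensor R m d) :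
  measurable_fun setT (fun y : tensor R m d => y + D).
Proof.
apply: measurable_fun_tensor => k.
under eq_fun do rewrite ffunE.
by apply: measurable_funD => //; exact: measurable_tensor_entry.
Qed.

Definition rectangle (B : mindex m d -> set R) : set (tensor R m d) :=
  [set y | forall k, B k (y k)].

Definition rectangles : set (set (tensor R m d)) :=
  [set A | exists2 B, (forall k, measurable (B k)) & A = rectangle B].

Lemma measurable_rectangle (B : mindex m d -> set R) :
  (forall k, measurable (B k)) -> measurable (rectangle B).
Proof.
move=> mB.
rewrite (_ : rectangle B = \bigcap_(k in [set: mindex m d])
    (fun y : tensor R m d => y k) @^-1` B k).
  apply: fin_bigcap_measurable => // k _.
  by rewrite -[X in measurable X]setTI; exact: measurable_tensor_entry.
apply/seteqP; split=> y yB k; first by move=> _; exact: yB.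
exact: (yB k Logic.I).
Qed.

(** Cylinders over one entry are rectangles whose other sides are the whole line. Rectangles are
    moreover stable under intersection, hence form a generating pi-system. *)
Lemma measurable_tensor_rectangles :
  @measurable _ (tensor R m d) = <<s rectangles >>.
Proof.
apply/seteqP; split; last first.
  apply: smallest_sub; first exact: sigma_algebra_measurable.
  by move=> _ [B mB ->]; exact: measurable_rectangle.
apply: smallest_sub; first exact: smallest_sigma_algebra.
move=> _ [k _ [B mB <-]]; apply: sub_sigma_algebra.
exists (fun j => if j == k then B else setT) => [j|]; first by case: ifP.
apply/seteqP; split=> y /=.
  by move=> [_ yB] j; case: eqP => // ->.
by move=> /(_ k); rewrite eqxx.
Qed.

End tensor_measurability.

(** * Change of measure for the noise tensor *)

Section gaussian_shift.
Context {R : realType} {m d : nat} {d0 : measure_display}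
  {Omega : measurableType d0}.
Variables (P : probability Omega R) (E : mindex m d -> {RV P >-> R}).
Hypothesis iidE : iid_std_normal E.

Definition noise (w : Omega) : tensor R m d := [ffun k => E k w].

Lemma measurable_noise : measurable_fun setT noise.
Proof.
apply: measurable_fun_tensor => k.
by under eq_fun do rewrite ffunE; exact: measurable_funPT.
Qed.

(** The density of the law of [noise + D] with respect to that of [noise], evaluated at the
    noise. *)
Definition likelihood_ratio (D : tensor R m d) (w : Omega) : R :=
  \prod_k gauss_lr (D k) (E k w).

Lemma measurable_likelihood_ratio (D : tensor R m d) :
  measurable_fun setT (likelihood_ratio D).
Proof.
apply: measurable_prod => k _; apply: measurableT_comp => //.
exact: measurable_gauss_lr.
Qed.

Lemma likelihood_ratio_ge0 (D : tensor R m d) (w : Omega) :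
  0 <= likelihood_ratio D w.
Proof. by apply: prodr_ge0 => k _; exact: gauss_lr_ge0. Qed.

Lemma indic_rectangle (B : mindex m d -> set R) (y : tensor R m d) :
  \1_(rectangle B) y = \prod_k \1_(B k) (y k) :> R.
Proof.
rewrite indicE; have [/set_mem yB|] := boolP (y \in rectangle B).
  by rewrite big1// => k _; rewrite indicE mem_set.
rewrite notin_setE => /existsNP[k nB].
by rewrite (bigD1 k)//= indicE memNset ?mul0r.
Qed.

(** Independence factors both sides over the entries, and each factor is the one-dimensional change
    of measure. *)
Lemma gaussian_shift_rectangle (D : tensor R m d) (B : mindex m d -> set R) :
  (forall k, measurable (B k)) ->
  pushforward P (fun w => noise w + D) (rectangle B) =
  weighted_law P (likelihood_ratio D) noise (rectangle B).
Proof.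
move=> mB.
have mBD k : measurable_fun setT (fun x : R => \1_(B k) (x + D k) : R).
  have mDk : measurable_fun setT (fun x : R => x + D k).
    exact: measurable_funD.
  by apply: (measurableT_comp _ mDk); exact: measurable_indic.
pose a k := fine (\int[P]_w (\1_(B k) (E k w + D k))%:E)%E.
have aE k : (\int[P]_w (\1_(B k) (E k w + D k))%:E = (a k)%:E)%E.
  rewrite /a fineK// ge0_fin_numE; last first.
    by apply: integral_ge0 => w _; rewrite lee_fin.
  apply: (@le_lt_trans _ _ (\int[P]_w (cst 1%:E w))%E).
    apply: ge0_le_integral => //.
    + by apply/measurable_EFinP; apply: (measurableT_comp (mBD k)).
    + by move=> w _; rewrite lee_fin indicE; case: (_ \in _).
  rewrite integral_cst// mul1e (le_lt_trans (probability_le1 P measurableT))//.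
  exact: ltry.
have mR : measurable (rectangle B) by exact: measurable_rectangle.
have mnD : measurable_fun setT (fun w => noise w + D).
  by apply: (measurableT_comp (measurable_tensorD D)); exact: measurable_noise.
transitivity (\prod_k a k)%:E.
  rewrite -(@integral_prod_independent _ _ _ P _ E iidE.1
    (fun k x => \1_(B k) (x + D k))) //.
  rewrite /pushforward -[X in P X]setIT -(integral_indic P measurableT).
    apply: eq_integral => w _; congr (_%:E).
    transitivity (\1_(rectangle B) (noise w + D) : R); first by rewrite !indicE.
    rewrite indic_rectangle; apply: eq_bigr => k _.
    by rewrite !ffunE.
  by rewrite -[X in measurable X]setTI; exact: mnD.
rewrite /weighted_law integral_mkcond.
rewrite -(@integral_prod_independent _ _ _ P _ E iidE.1
    (fun k x => \1_(B k) x * gauss_lr (D k) x)) //.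
- apply: eq_integral => w _; rewrite big_split/= patchE.
  have := indic_rectangle B (noise w); rewrite indicE.
  under eq_bigr do rewrite ffunE; move=> <-.
  have -> : (w \in noise @^-1` rectangle B) = (noise w \in rectangle B).
    by apply/idP/idP; rewrite !inE.
  by case: ifPn => _; rewrite ?mul1r ?mul0r.
- move=> k; apply: measurable_funM; first exact: measurable_indic.
  exact: measurable_gauss_lr.
- by move=> k x; rewrite mulr_ge0// gauss_lr_ge0.
- move=> k; rewrite -aE.
  apply: (integral_std_normal_lr P (E k) (iidE.2 k) (D k) (\1_(B k))) => //.
Qed.

(** Both sides are measures in [A] that agree on the pi-system of rectangles. *)
Lemma gaussian_shift (D : tensor R m d) (A : set (tensor R m d)) :
  measurable A ->
  P [set w | A (noise w + D)] =
  (\int[P]_(w in noise @^-1` A) (likelihood_ratio D w)%:E)%E.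
Proof.
move=> mA.
have mnD : measurable_fun setT (fun w => noise w + D).
  by apply: (measurableT_comp (measurable_tensorD D)); exact: measurable_noise.
have rT : rectangle (fun=> setT) = [set: tensor R m d].
  by apply/seteqP; split.
apply: (@measure_unique _ R _ rectangles (fun=> setT) _ _ _ _
  (pushforward P (fun w => noise w + D))
  (weighted_law P (likelihood_ratio D) noise)) => //.
- exact: measurable_tensor_rectangles.
- move=> _ _ [B1 mB1 ->] [B2 mB2 ->].
  exists (fun k => B1 k `&` B2 k) => [k|]; first exact: measurableI.
  apply/seteqP; split=> y /= yB.
    by move=> k; split; [exact: yB.1 | exact: yB.2].
  by split=> k; case: (yB k).
- by move=> _; exists (fun=> setT); rewrite ?rT.
- by apply/seteqP; split=> // y _; exists 0%N.
- exact: measurable_likelihood_ratio.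
- exact: likelihood_ratio_ge0.
- exact: measurable_noise.
- by move=> ? ? ? _ [B mB ->]; exact: gaussian_shift_rectangle.
- by move=> _; exact: le_lt_trans (probability_le1 P measurableT) (ltry 1).
Qed.

Lemma integral_likelihood_ratio (D : tensor R m d) :
  (\int[P]_w (likelihood_ratio D w)%:E = 1)%E.
Proof.
have := gaussian_shift D setT measurableT.
by move=> <-; exact: probability_setT.
Qed.

Lemma likelihood_ratio_sqr (D : tensor R m d) (w : Omega) :
  likelihood_ratio D w ^+ 2 =
  expR (\sum_k D k ^+ 2) * likelihood_ratio (D *+ 2) w.
Proof.
rewrite /likelihood_ratio -prodrXl expR_sum -big_split/=.
by apply: eq_bigr => k _; rewrite gauss_lr_sqr ffunMnE mulr_natl.
Qed.

(* Quantitative contiguity: with L the likelihood ratio, L <= lam + L^2 / lam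
   and E[L^2] = exp(|D|^2). *)
Lemma gaussian_shift_le (Theta D : tensor R m d) (A : set (tensor R m d))
    (lam : R) : measurable A -> 0 < lam ->
  (P [set w | A (Theta + D + noise w)%R] <=
   lam%:E * P [set w | A (Theta + noise w)%R] +
   (expR (\sum_k D k ^+ 2) / lam)%:E)%E.
Proof.
move=> mA lam0.
pose A' := (fun y => y + Theta) @^-1` A.
have mA' : measurable A'.
  by rewrite /A' -[X in measurable X]setTI; exact: measurable_tensorD.
have -> : [set w | A (Theta + D + noise w)] = [set w | A' (noise w + D)].
  by apply: eq_set => w; rewrite /A' /= addrC (addrC Theta) addrA.
have -> : [set w | A (Theta + noise w)] = noise @^-1` A'.
  by apply: eq_set => w; rewrite /A' /= addrC.
have mnA : measurable (noise @^-1` A').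
  by rewrite -[X in measurable X]setTI; exact: measurable_noise.
have mL := measurable_likelihood_ratio.
have L0 := likelihood_ratio_ge0.
rewrite gaussian_shift//.
(* [c * likelihood_ratio (D *+ 2)] is L^2 / lam, and its integral is [c]. *)
pose c := expR (\sum_k D k ^+ 2) / lam.
have c0 : 0 <= c by rewrite divr_ge0 ?expR_ge0 ?ltW.
apply: (@le_trans _ _ (\int[P]_(w in noise @^-1` A')
    (lam%:E + (c * likelihood_ratio (D *+ 2) w)%:E))%E).
  apply: ge0_le_integral => //.
  - by move=> w _; rewrite lee_fin.
  - by apply: measurable_funTS; exact/measurable_EFinP.
  - apply: measurable_funTS; apply: emeasurable_funD => //.
    by apply/measurable_EFinP; exact: measurable_funM.
  - move=> w _; rewrite -EFinD lee_fin /c mulrAC -likelihood_ratio_sqr.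
    have := L0 D w; set l := likelihood_ratio D w => l0.
    have [llam|laml] := leP l lam.
      by rewrite (le_trans llam)// lerDl divr_ge0 ?sqr_ge0 ?ltW.
    by rewrite ler_wpDl ?ltW// lter_pdivlMr// expr2 ltr_pM2l// (lt_trans lam0).
rewrite ge0_integralD//; last 3 first.
  - by move=> w _; rewrite lee_fin ltW.
  - by move=> w _; rewrite lee_fin mulr_ge0.
  - apply: measurable_funTS.
    by apply/measurable_EFinP; exact: measurable_funM.
rewrite integral_cst// leeD2l//.
apply: (@le_trans _ _ (\int[P]_w (c * likelihood_ratio (D *+ 2) w)%:E)%E).
  apply: ge0_subset_integral => //.
  - by apply/measurable_EFinP; exact: measurable_funM.
  - by move=> w _; rewrite lee_fin mulr_ge0.
under eq_integral do rewrite EFinM.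
rewrite ge0_integralZl_EFin//.
- by rewrite integral_likelihood_ratio mule1.
- by move=> w _; rewrite lee_fin.
- exact/measurable_EFinP.
Qed.

End gaussian_shift.

(** * Reduction to a packing problem *)

Section sum_of_squares.
Context {R : realType} {m d : nat}.
Implicit Types y z : tensor R m d.

Definition sumsq y : R := \sum_k y k ^+ 2.

Lemma MSE_sumsq y z : MSE y z = (d%:R ^+ m)^-1 * sumsq (y - z).
Proof.
by rewrite /MSE /frobenius sqr_sqrtr// sumr_ge0// => k _; exact: sqr_ge0.
Qed.

(** The right side exceeds the left one by the sum of the squares of (x - y) + (x - z). *)
Lemma sumsqB_le (x y z : tensor R m d) :
  sumsq (y - z) <= 2 * sumsq (x - y) + 2 * sumsq (x - z).
Proof.
rewrite /sumsq !mulr_sumr -big_split/=; apply: ler_sum => k _.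
rewrite !ffunE; have := sqr_ge0 ((x k - y k) + (x k - z k)).
nra.
Qed.

Lemma tensor_perm1 y : tensor_perm y 1 = y.
Proof.
apply/ffunP => k; rewrite ffunE; congr (y _).
by apply: eq_from_tnth => q; rewrite tnth_map perm1.
Qed.

Lemma measurable_sumsqB (f : tensor R m d -> tensor R m d) z :
  measurable_fun setT f -> measurable_fun setT (fun y => sumsq (f y - z)).
Proof.
move=> mf; apply: measurable_sum => k.
under eq_fun do rewrite !ffunE.
apply: measurable_funX; apply: measurable_funB => //.
by apply: (measurableT_comp (measurable_tensor_entry k)).
Qed.

(** There are finitely many permutations, so each entry is a finite sum of entries of [e.1] cut off
    by the level sets of [e.2]. *)
Lemma measurable_estimate (e : (tensor R m d -> tensor R m d) *
    (tensor R m d -> {perm 'I_d})) : estimators e ->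
  measurable_fun setT (fun y => tensor_perm (e.1 y) (e.2 y)).
Proof.
move=> [me1 me2]; apply: measurable_fun_tensor => k.
rewrite (_ : (fun y => _) = fun y => \sum_(s : {perm 'I_d})
    \1_(e.2 @^-1` [set s]) y * e.1 y (map_tuple s k)); last first.
  apply/funext => y; rewrite ffunE (bigD1 (e.2 y))//= big1 ?addr0.
    by rewrite indicE mem_set ?mul1r.
  move=> s sy; rewrite indicE memNset ?mul0r//= => eys.
  by rewrite eys eqxx in sy.
apply: measurable_sum => s; apply: measurable_funM.
  exact: measurable_indic.
exact: (measurableT_comp (measurable_tensor_entry _)).
Qed.

End sum_of_squares.

(** The sum of the probabilities is the expected number of events that occur. *)
Lemma sum_probability_le {R : realType} {d0 : measure_display}
    {Omega : measurableType d0} (P : probability Omega R) (T : finType)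
    (B : T -> set Omega) (V : R) :
  (forall s, measurable (B s)) -> 0 <= V ->
  (forall w, \sum_s \1_(B s) w <= V) ->
  (\sum_s P (B s) <= V%:E)%E.
Proof.
move=> mB V0 BV.
have -> : (\sum_s P (B s) = \int[P]_w (\sum_s \1_(B s) w)%:E)%E.
  under [in RHS]eq_integral do rewrite -sumEFin.
  rewrite ge0_integral_sum//.
  - by apply: eq_bigr => s _; rewrite integral_indic// setIT.
  - by move=> s; apply/measurable_EFinP; exact: measurable_indic.
apply: (@le_trans _ _ (\int[P]_w (cst V%:E w))%E).
  apply: ge0_le_integral => //.
  - by move=> w _; rewrite lee_fin sumr_ge0.
  - apply/measurable_EFinP; apply: measurable_sum => s.
    exact: measurable_indic.
  - by move=> w _; rewrite lee_fin.
rewrite integral_cst//.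
rewrite -[leRHS]mule1 lee_wpmul2l ?lee_fin//.
exact: probability_le1.
Qed.

(* The confidence sets { Y : the estimate is within sqrt t of Th s } overlap at
   most V times, so under the reference Th0 most of them are unlikely; by
   contiguity they are then also unlikely under their own Th s. *)
Lemma minimax_prob_ge {R : realType} {m d : nat} {d0 : measure_display}
    {Omega : measurableType d0} (P : probability Omega R)
    (E : mindex m d -> {RV P >-> R}) (S : set (tensor R m d))
    (T : finType) (Th : T -> tensor R m d) (Th0 : tensor R m d) (t D : R)
    (V : R) :
  iid_std_normal E -> (0 < d)%N ->
  (forall s, S (Th s)) -> (forall s, sumsq (Th s - Th0) <= D) ->
  0 <= V ->
  (forall s0, #|[pred s | sumsq (Th s - Th s0) <= 4 * t]|%:R <= V) ->
  100 * expR D * V < #|T|%:R ->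
  ((8 / 10)%:E <= minimax_prob E S ((d%:R ^+ m)^-1 * t))%E.
Proof.
move=> iidE d_gt0 STh ThD V0 ThV VT; apply: le_ereal_inf_tmp => _ [e ee <-].
set sup := ereal_sup _; rewrite leNgt; apply/negP => sup8.
pose est y := tensor_perm (e.1 y) (e.2 y).
have mest : measurable_fun setT est by exact: measurable_estimate.
pose A s := [set y | sumsq (est y - Th s) < t].
have mA s : measurable (A s).
  have := measurable_sumsqB est (Th s) mest => mf.
  rewrite (_ : A s = (fun y => sumsq (est y - Th s)) @^-1` `]-oo, t[).
    rewrite -[X in measurable X]setTI; exact: mf.
  by apply/seteqP; split=> y /=; rewrite in_itv.
have mnoise Theta : measurable_fun setT (fun w => Theta + noise P E w).
  rewrite (_ : (fun w => _) = (fun y => y + Theta) \o noise P E); last first.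
    by apply/funext => w /=; rewrite addrC.
  by apply: measurableT_comp;
    [exact: measurable_tensorD|exact: measurable_noise].
have mB Theta s : measurable [set w | A s (Theta + noise P E w)].
  by have := mnoise Theta measurableT _ (mA s); rewrite setTI.
(* This makes the contiguity error at most 1/10. Under [Th s] the event [A s] will have probability
   above 2/10, so [lam] times its probability under [Th0] is at least 1/10. *)
pose lam := 10 * expR D.
have lam0 : 0 < lam by rewrite mulr_gt0 ?expR_gt0.
have PA s : ((100 * expR D)^-1%:E <= P [set w | A s (Th0 + noise P E w)%R])%E.
  (* [Th s] with the identity permutation is an admissible parameter, and the complement of [A s] is
     the event of a large MSE there. *)
  have supP : (P (~` [set w | A s (Th s + noise P E w)%R]) < (8 / 10)%:E)%E.
    apply: le_lt_trans sup8; apply: ereal_sup_ubound; exists (Th s) => //.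
    exists 1%g => //; congr (P _); apply: eq_set => w.
    rewrite /observation tensor_perm1 MSE_sumsq ler_pM2l; last first.
      by rewrite invr_gt0 exprn_gt0// ltr0n.
    rewrite -/(noise P E w) -/(est _).
    by apply/propext; rewrite leNgt; split=> /negP.
  move: supP; rewrite probability_setC//.
  have := gaussian_shift_le P E iidE Th0 (Th s - Th0) (A s) lam (mA s) lam0.
  rewrite (addrC Th0) subrK.
  have : (expR (\sum_k (Th s - Th0) k ^+ 2) / lam <= 10^-1)%R.
    rewrite ler_pdivrMr// /lam mulrA mulVf// mul1r ler_expR; exact: ThD.
  set q := (expR _ / lam)%R.
  rewrite -(fineK (fin_num_measure P _ (mB (Th s) s))).
  rewrite -(fineK (fin_num_measure P _ (mB Th0 s))).
  set p1 := fine _; set p0 := fine _ => q10.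
  rewrite -EFinM -!EFinD lee_fin lte_fin => p1le p18.
  have : 10^-1 <= lam * p0 by lra.
  rewrite /lam => H.
  have H1 : (1 <= p0 * (100 * expR D))%R by lra.
  by rewrite lee_fin -div1r ler_pdivrMr ?mulr_gt0 ?expR_gt0.
(* Once the estimate is close to one [Th s0], every other [Th s] close to it satisfies the condition
   counted by [ThV s0]. *)
have overlap w : \sum_s \1_[set w | A s (Th0 + noise P E w)] w <= V.
  have [[s0 As0]|noA] := pselect (exists s, A s (Th0 + noise P E w));
    last first.
    rewrite big1// => s _; rewrite indicE memNset//= => As.
    by apply: noA; exists s.
  apply: le_trans (ThV s0); rewrite -sum1_card natr_sum [leRHS]big_mkcond/=.
  apply: ler_sum => s _; rewrite indicE.
  have [/set_mem As|_] := boolP (w \in _); last by case: ifP.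
  rewrite (_ : s \in _ = true)// inE.
  apply: le_trans (sumsqB_le (est (Th0 + noise P E w)) _ _) _.
  by move: As0 As; rewrite /A/=; lra.
(* Summing the lower bounds [PA] over [T] gives #|T| <= 100 exp(D) V, against the last
   hypothesis. *)
have := sum_probability_le P T _ V (mB Th0) V0 overlap.
have : (\sum_(s : T) (100 * expR D)^-1%:E <=
    \sum_s P [set w | A s (Th0 + noise P E w)%R])%E.
  by apply: lee_sum => s _; exact: PA.
move=> /le_trans /[apply].
rewrite sumEFin lee_fin sumr_const -[leLHS]mulr_natr mulrC.
rewrite ler_pdivrMr ?mulr_gt0 ?expR_gt0// leNgt => /negP; apply.
by rewrite mulrC.
Qed.

(** * Hamming balls *)

Section hamming_ball.
Context {R : realType} {B : finType}.

Definition hamming (s s' : {ffun B -> bool}) : nat := #|[pred b | s b != s' b]|.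

(* Chernoff: bound the indicator of 8 h <= N by (3/2)^(N - 8 h). *)
Lemma card_hamming_ball (s0 : {ffun B -> bool}) :
  #|[pred s | (8 * hamming s s0 <= #|B|)%N]|%:R <= (8 / 5) ^+ #|B| :> R.
Proof.
(* The Chernoff weight is (3/2)^N x^h with N = #|B| and h the distance; numerically (3/2)(1 + x) <=
   8/5. *)
pose x : R := (2 / 3) ^+ 8.
have x0 : 0 <= x by rewrite exprn_ge0// divr_ge0.
apply: (@le_trans _ _ (\sum_s (3 / 2) ^+ #|B| * x ^+ hamming s s0)).
  rewrite -sum1_card natr_sum big_mkcond/=; apply: ler_sum => s _.
  case: ifPn => [|_]; last by rewrite mulr_ge0// exprn_ge0// divr_ge0.
  rewrite inE => h8; rewrite -exprM -(subnK h8) exprD -mulrA -exprMn.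
  rewrite (_ : 3 / 2 * (2 / 3) = 1 :> R); last by field.
  by rewrite expr1n mulr1 exprn_ege1//; lra.
rewrite -mulr_sumr.
(* The generating function of the Hamming distance factors over the coordinates. *)
have -> : \sum_s x ^+ hamming s s0 = (1 + x) ^+ #|B|.
  transitivity (\sum_(s : {ffun B -> bool})
      \prod_b (if s b != s0 b then x else 1)).
    apply: eq_bigr => s _; rewrite -big_mkcond/= prodr_const.
    by congr (_ ^+ _); apply: eq_card => b; rewrite !inE.
  rewrite -(bigA_distr_bigA (fun b v => if v != s0 b then x else 1)).
  under eq_bigr do rewrite big_bool/=.
  rewrite -[RHS]prodr_const; apply: eq_bigr => b _.
  by case: (s0 b) => //=; rewrite addrC.
rewrite -exprMn lerXn2r// ?nnegrE ?mulr_ge0 ?divr_ge0 ?addr_ge0//.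
by rewrite /x; lra.
Qed.

Lemma ler_sum_inj {A K : finType} (h : A -> K) (Q : pred A) (F : K -> R) :
  injective h -> (forall k, 0 <= F k) ->
  \sum_(p | Q p) F (h p) <= \sum_k F k.
Proof.
move=> hinj F0.
have -> : \sum_(p | Q p) F (h p) = \sum_(k in h @: [set p | Q p]%SET) F k.
  rewrite big_imset/=; last by move=> ? ? _ _; exact: hinj.
  by apply: eq_bigl => p; rewrite inE.
by rewrite [leRHS](bigID (mem (h @: [set p | Q p]%SET)))/= lerDl sumr_ge0.
Qed.

End hamming_ball.

(** * Ramps with tents *)

Section bumps.
Context {R : realType} {m : nat}.
Implicit Types x y : 'rV[R]_m.

Lemma rV_entry_le_norm x (q : 'I_m) : `|x ord0 q| <= `|x|.
Proof.
by rewrite [leRHS]/Num.Def.normr /= mx_normrE; apply: (le_bigmax _ _ (ord0, q)).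
Qed.

Lemma rV_norm_le x (e : R) :
  0 <= e -> (forall q, `|x ord0 q| <= e) -> `|x| <= e.
Proof.
move=> e0 xe; rewrite [leLHS]/Num.Def.normr /= mx_normrE.
by apply: bigmax_le => // -[i q] _ /=; rewrite (ord1 i).
Qed.

Lemma rV_norm_le_sum x : (forall q, 0 <= x ord0 q) -> `|x| <= \sum_q x ord0 q.
Proof.
move=> x0; apply: rV_norm_le => [|q]; first by apply: sumr_ge0.
by rewrite ger0_norm// (bigD1 q)//= lerDl sumr_ge0.
Qed.

(* The cube is cut into K ^ m blocks of side 4u/d; block z carries the tent of
   radius 2u/d centred at its centre, which is at least u/d on the concentric
   block of half side. *)
Variables (d u K : nat).
Hypotheses (u_gt0 : (0 < u)%N) (dK : (K * (4 * u) <= d)%N).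

Definition center (z : mindex m K) : 'rV[R]_m :=
  \row_q ((4 * u * tnth z q + 2 * u)%N%:R / d%:R).

Definition radius : R := (2 * u)%N%:R / d%:R.

(** A maximum of tents, instead of a sum, is 1-Lipschitz for every [s]; the default value 0
    truncates the tents. *)
Definition bump (s : {ffun mindex m K -> bool}) x : R :=
  \big[Num.max/0]_(z | s z) (radius - `|x - center z|).

Lemma radius_ge0 : 0 <= radius.
Proof. exact: divr_ge0. Qed.

Lemma bump_ge0 s x : 0 <= bump s x.
Proof. exact: bigmax_ge_id. Qed.

Lemma bump_le_radius s x : bump s x <= radius.
Proof. by apply: bigmax_le => [|z _]; rewrite ?radius_ge0// gerBl. Qed.

Lemma bump_lip s x y : bump s x <= bump s y + `|x - y|.
Proof.
apply: bigmax_le => [|z sz]; first by rewrite addr_ge0// bump_ge0.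
apply: (@le_trans _ _ (radius - `|y - center z| + `|x - y|)).
  have := ler_normD (x - center z) (y - x).
  have -> : x - center z + (y - x) = y - center z by rewrite addrC addrA subrK.
  by rewrite (distrC x y); lra.
rewrite lerD2r.
exact: (le_bigmax_cond _ (fun z => radius - `|y - center z|)).
Qed.

Definition middle_val (p : mindex m K * m.-tuple 'I_(2 * u)) (q : 'I_m) : nat :=
  (tnth p.1 q * (4 * u) + (u + tnth p.2 q))%N.

Lemma middle_val_lt p q : (middle_val p q < d)%N.
Proof.
apply: leq_trans dK; rewrite /middle_val.
have := ltn_ord (tnth p.1 q); have := ltn_ord (tnth p.2 q).
move: (val _) => o o2; move: (val _) => i iK.
apply: (@leq_trans (i.+1 * (4 * u))%N); first by lia.
by rewrite leq_mul2r iK orbT.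
Qed.

Definition middle (p : mindex m K * m.-tuple 'I_(2 * u)) : mindex m d :=
  [tuple Ordinal (middle_val_lt p q) | q < m].

Lemma tnth_middle p q : tnth (middle p) q = middle_val p q :> nat.
Proof. by rewrite tnth_mktuple. Qed.

Lemma middle_inj : injective middle.
Proof.
move=> [z o] [z' o'] eq_mid.
have eq_val q : (tnth z q = tnth z' q :> nat) /\ (tnth o q = tnth o' q :> nat).
  have := congr1 (fun k => val (tnth k q)) eq_mid.
  rewrite /= !tnth_middle /middle_val/=.
  have := ltn_ord (tnth o q); have := ltn_ord (tnth o' q) => o'2 o2 eqv.
  (* Euclidean division by 4u recovers the block, since u + o < 4u. *)
  have eqz : tnth z q = tnth z' q :> nat.
    have := congr1 (fun k => k %/ (4 * u))%N eqv.
    rewrite !divnMDl ?muln_gt0//.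
    by rewrite !divn_small ?addn0//; lia.
  by split => //; move: eqv; rewrite eqz => /addnI/addnI.
by congr (_, _); apply: eq_from_tnth => q; apply: val_inj; case: (eq_val q).
Qed.

Let d_gt0 (p : mindex m K * m.-tuple 'I_(2 * u)) (q : 'I_m) : 0 < d%:R :> R.
Proof. by rewrite ltr0n; apply: leq_ltn_trans (middle_val_lt p q). Qed.

(** As [grid] adds one to each index, an offset o in [0, 2u) lies at (o + 1 - u)/d from the centre,
    and o + 1 - u ranges over [1 - u, u]. *)
Lemma middle_near p : `|grid (middle p) - center p.1| <= u%:R / d%:R.
Proof.
apply: rV_norm_le => [|q]; first exact: divr_ge0.
have di : 0 < d%:R^-1 :> R by rewrite invr_gt0 (d_gt0 p q).
rewrite !mxE -mulrBl normrM (ger0_norm (ltW di)) ler_pM2r//.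
rewrite tnth_middle /middle_val.
have : ((tnth p.2 q).+1%:R <= (2 * u)%N%:R :> R) by rewrite ler_nat.
have : 0 <= (tnth p.2 q)%:R :> R by [].
rewrite -!natr1 !natrD !natrM ler_norml => o0 o2.
by apply/andP; split; lra.
Qed.

(** In a coordinate where the blocks differ, the centres are at least 4u/d apart while the point is
    within u/d of its own, which leaves 3u/d. *)
Lemma middle_far p z : z != p.1 -> radius <= `|grid (middle p) - center z|.
Proof.
move=> zp.
have [q zq] : exists q, tnth z q != tnth p.1 q.
  apply/existsP; rewrite -negb_forall; apply: contra zp => /forallP zE.
  by apply/eqP/eq_from_tnth => q; apply/eqP.
apply: le_trans (rV_entry_le_norm _ q).
have di : 0 < d%:R^-1 :> R by rewrite invr_gt0 (d_gt0 p q).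
rewrite !mxE -mulrBl normrM (ger0_norm (ltW di)).
rewrite /radius ler_pM2r// tnth_middle /middle_val.
have : ((tnth p.2 q).+1%:R <= (2 * u)%N%:R :> R) by rewrite ler_nat.
have : 0 <= (tnth p.2 q)%:R :> R by [].
have u0 : 0 <= u%:R :> R by [].
rewrite -!natr1 !natrD !natrM => o0 o2.
have [zlt|zgt|/val_inj zE] := ltngtP (tnth z q) (tnth p.1 q).
- have : ((tnth z q).+1%:R <= (tnth p.1 q)%:R :> R) by rewrite ler_nat.
  rewrite -natr1 => zle; rewrite ler_normr; apply/orP; left; nra.
- have : ((tnth p.1 q).+1%:R <= (tnth z q)%:R :> R) by rewrite ler_nat.
  rewrite -natr1 => zle; rewrite ler_normr; apply/orP; right; nra.
- by rewrite zE eqxx in zq.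
Qed.

Lemma bump_middle_on (s : {ffun mindex m K -> bool})
    (p : mindex m K * m.-tuple 'I_(2 * u)) :
  s p.1 -> u%:R / d%:R <= bump s (grid (middle p)).
Proof.
move=> sp; have := middle_near p.
have := le_bigmax_cond 0 (fun z => radius - `|grid (middle p) - center z|) sp.
rewrite -/(bump s _) /radius natrM; lra.
Qed.

Lemma bump_middle_off (s : {ffun mindex m K -> bool})
    (p : mindex m K * m.-tuple 'I_(2 * u)) :
  ~~ s p.1 -> bump s (grid (middle p)) <= 0.
Proof.
move=> sp; apply: bigmax_le => // z sz; rewrite subr_le0 middle_far//.
by apply: contraNneq sp => <-.
Qed.

Variables a b : R.
Hypotheses (b_ge0 : 0 <= b) (a_ge0 : 0 <= a).

Definition ramp_bump (s : {ffun mindex m K -> bool}) x : R :=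
  a * \sum_q x ord0 q + b * bump s x.

Lemma ramp_bump_lip s x y :
  `|ramp_bump s x - ramp_bump s y| <= (a * m%:R + b) * `|x - y|.
Proof.
have sum_lip : `|\sum_q x ord0 q - \sum_q y ord0 q| <= m%:R * `|x - y|.
  rewrite -sumrB; apply: le_trans (ler_norm_sum _ _ _) _.
  apply: (@le_trans _ _ (\sum_(q < m) `|x - y|)); last first.
    by rewrite sumr_const card_ord mulr_natl.
  apply: ler_sum => q _; have := rV_entry_le_norm (x - y) q.
  by rewrite !mxE.
have bump_lip2 : `|bump s x - bump s y| <= `|x - y|.
  have := bump_lip s x y; have := bump_lip s y x.
  by rewrite (distrC y x) ler_norml => ? ?; apply/andP; split; lra.
have -> : ramp_bump s x - ramp_bump s y =
    a * (\sum_q x ord0 q - \sum_q y ord0 q) + b * (bump s x - bump s y).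
  by rewrite /ramp_bump; ring.
apply: le_trans (ler_normD _ _) _; rewrite !normrM (ger0_norm a_ge0).
by rewrite (ger0_norm b_ge0) mulrDl -mulrA lerD// ler_wpM2l.
Qed.

(** Along an increase the bump loses at most the sup norm of y - x, hence at most the sum of the
    increments, which the ramp gains [a] times. *)
Lemma ramp_bump_incr s x y : (forall q, x ord0 q <= y ord0 q) ->
  (a - b) * \sum_q (y ord0 q - x ord0 q) <= ramp_bump s y - ramp_bump s x.
Proof.
move=> xy.
have := bump_lip s x y.
have : `|y - x| <= \sum_q (y ord0 q - x ord0 q).
  apply: le_trans (rV_norm_le_sum _ _) _; last first.
    by apply: ler_sum => q _; rewrite !mxE.
  by move=> q; rewrite !mxE subr_ge0.
rewrite distrC sumrB /ramp_bump => xy_le lip.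
set sx := \sum_q x _ _ in xy_le *; set sy := \sum_q y _ _ in xy_le *.
have : 0 <= b * (sy - sx + (bump s y - bump s x)) by apply: mulr_ge0 => //; lra.
lra.
Qed.

Definition ramp_tensor (s : {ffun mindex m K -> bool}) : tensor R m d :=
  [ffun k => ramp_bump s (grid k)].

(** The ramps cancel and both bumps lie in [0, radius]. *)
Lemma sumsq_ramp_tensor_le s s' :
  sumsq (ramp_tensor s - ramp_tensor s') <= d%:R ^+ m * (b * radius) ^+ 2.
Proof.
apply: (@le_trans _ _ (\sum_(k : mindex m d) (b * radius) ^+ 2)).
  apply: ler_sum => k _; rewrite !ffunE /ramp_bump.
  have -> : a * (\sum_q grid k ord0 q) + b * bump s (grid k) -
      (a * (\sum_q grid k ord0 q) + b * bump s' (grid k)) =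
      b * (bump s (grid k) - bump s' (grid k)) by ring.
  rewrite !(exprMn _ b) ler_wpM2l ?sqr_ge0//.
  have := bump_ge0 s (grid k); have := bump_le_radius s (grid k).
  have := bump_ge0 s' (grid k); have := bump_le_radius s' (grid k).
  move: (bump s _) (bump s' _) => x y yr y0 xr x0.
  have : 0 <= (radius - (x - y)) * (radius + (x - y)).
    by apply: mulr_ge0; lra.
  rewrite !expr2; lra.
by rewrite sumr_const card_tuple card_ord -natrX mulr_natl.
Qed.

(** Each block where s and s' differ has (2u)^m grid points in its concentric half; there one bump
    vanishes and the other is at least u/d. *)
Lemma sumsq_ramp_tensor_ge s s' :
  (hamming s s')%:R * ((2 * u)%N%:R ^+ m * (b * (u%:R / d%:R)) ^+ 2) <=
  sumsq (ramp_tensor s - ramp_tensor s').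
Proof.
pose F k := (ramp_tensor s - ramp_tensor s') k ^+ 2.
apply: le_trans (ler_sum_inj middle
  (fun p : mindex m K * m.-tuple 'I_(2 * u) => s p.1 != s' p.1) F _ _);
  last 2 first.
- exact: middle_inj.
- by move=> k; exact: sqr_ge0.
apply: (@le_trans _ _ (\sum_(p : mindex m K * m.-tuple 'I_(2 * u) |
    s p.1 != s' p.1) (b * (u%:R / d%:R)) ^+ 2)).
  rewrite sumr_const -[leRHS]mulr_natl.
  rewrite (_ : #|_| = (hamming s s' * (2 * u) ^ m)%N).
    by rewrite [in leRHS]natrM natrX mulrA.
  rewrite -[X in (_ * X ^ m)%N](card_ord (2 * u)) -card_tuple -cardX.
  by apply: eq_card => -[z o]; rewrite !inE andbT.
apply: ler_sum => p sp; rewrite /F !ffunE /ramp_bump.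
have -> : a * (\sum_q grid (middle p) ord0 q) + b * bump s (grid (middle p)) -
    (a * (\sum_q grid (middle p) ord0 q) + b * bump s' (grid (middle p))) =
    b * (bump s (grid (middle p)) - bump s' (grid (middle p))) by ring.
rewrite !(exprMn _ b) ler_wpM2l ?sqr_ge0//.
have ud0 : 0 <= u%:R / d%:R :> R by exact: divr_ge0.
have := bump_ge0 s (grid (middle p)); have := bump_ge0 s' (grid (middle p)).
move: sp; case: (boolP (s p.1)) => sp; case: (boolP (s' p.1)) => // s'p _.
- have := bump_middle_on s p sp; have := bump_middle_off s' p s'p; nra.
- have := bump_middle_off s p sp; have := bump_middle_on s' p s'p; nra.
Qed.

End bumps.

(** * Membership in the monotone classes *)

Section monotone_classes.
Context {R : realType}.

(** A slope condition that settles both classes: c >= 0 gives the isotonic one, c > 0 the Lipschitz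
    monotonic one. *)
Definition coordinatewise_growth {m : nat} (c : R) (f : 'rV[R]_m -> R) : Prop :=
  forall x y : 'rV[R]_m, (forall q, x ord0 q <= y ord0 q) ->
    c * \sum_q (y ord0 q - x ord0 q) <= f y - f x.

Lemma growth_isotonic {m : nat} (c : R) (f : 'rV[R]_m -> R) :
  0 <= c -> coordinatewise_growth c f -> isotonic_class f.
Proof.
move=> c0 fc x y _ _ xy; rewrite -subr_ge0; apply: le_trans (fc x y xy).
by rewrite mulr_ge0// sumr_ge0// => q _; rewrite subr_ge0.
Qed.

Lemma slice_sum {n d : nat} (i : 'I_d) (F : mindex n.+1 d -> R) :
  \sum_(k : mindex n.+1 d | ohead k == Some i) F k =
  \sum_(t : n.-tuple 'I_d) F [tuple of i :: t].
Proof.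
rewrite (reindex_onto (fun t : n.-tuple 'I_d => [tuple of i :: t])
  (fun k : mindex n.+1 d => [tuple of behead k])).
  apply: eq_bigl => t; rewrite eqxx/=.
  by apply/eqP/val_inj.
move=> k; rewrite (tuple_eta k) /= => /eqP[<-].
by apply: val_inj.
Qed.

(** Grid points of the two slices are paired by their common tail; a pair differs only in its first
    coordinate, by (i - j)/d. *)
Lemma growth_lip_monotonic {n : nat} (c : R) (f : 'rV[R]_n.+1 -> R) :
  0 < c -> coordinatewise_growth c f -> lip_monotonic_class f.
Proof.
move=> c0 fc; exists c^-1; first by rewrite invr_gt0.
move=> d i j ji; rewrite ler_pdivlMl// /slice_mean !slice_sum -mulrBr -sumrB/=.
have d0 : 0 < d%:R :> R by rewrite ltr0n (leq_ltn_trans _ (ltn_ord i)).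
rewrite ler_pdivlMl ?exprn_gt0//.
apply: (@le_trans _ _ (\sum_(t : n.-tuple 'I_d) c * ((i%:R - j%:R) / d%:R))).
  by rewrite sumr_const card_tuple card_ord -[leRHS]mulr_natl natrX.
apply: ler_sum => t _.
apply: le_trans (fc (grid [tuple of j :: t]) (grid [tuple of i :: t]) _).
  rewrite ler_pM2l// big_ord_recl big1 => [|q _]; last first.
    by rewrite !mxE !(tnth_nth j)/= subrr.
  rewrite addr0 !mxE !(tnth_nth j)/= -mulrBl -!natr1.
  by rewrite opprD addrACA subrr addr0.
move=> q; rewrite !mxE ler_pM2r ?invr_gt0// ler_nat ltnS !(tnth_nth j)/=.
by case: (unliftP ord0 q) => [q' ->|->].
Qed.

Lemma ramp_tensor_smooth {n d u K : nat} (a b L : R)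
    (M : set ('rV[R]_n.+1 -> R)) (s : {ffun mindex n.+1 K -> bool}) :
  M = @isotonic_class R n.+1 \/ M = @lip_monotonic_class R n.+1 ->
  0 <= b -> b < a -> a * n.+1%:R + b <= L ->
  smooth_tensors L M (ramp_tensor d u K a b s).
Proof.
move=> hM b0 ba abL; have a0 : 0 <= a by rewrite (le_trans b0)// ltW.
exists (ramp_bump d u K a b s); last by move=> k; rewrite ffunE.
have growth : coordinatewise_growth (a - b) (ramp_bump d u K a b s).
  by move=> x y; exact: ramp_bump_incr.
split.
  move=> x y _ _; apply: le_trans (ramp_bump_lip _ _ _ _ _ _ _ _ _ _) _ => //.
  by rewrite ler_wpM2r.
case: hM => ->.
- by apply: growth_isotonic growth; rewrite subr_ge0 ltW.
- by apply: growth_lip_monotonic growth; rewrite subr_gt0.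
Qed.

End monotone_classes.

(** * Rates *)

(* The bandwidth u/d balances bias and variance: u^(m+2) is about d^2. *)
Lemma block_scale (m d k : nat) : (2 <= m)%N -> (0 < k)%N ->
  (64 * k ^ 2 <= d)%N ->
  exists u, [/\ (0 < u)%N, (u ^ m.+2 <= d ^ 2)%N, (d ^ 2 <= (2 * u) ^ m.+2)%N,
    (d <= d %/ (4 * u) * (8 * u))%N & (k <= d %/ (4 * u))%N].
Proof.
move=> m2 k0 kd.
have d64 : (64 <= d)%N.
  by apply: leq_trans kd; rewrite leq_pmulr// expn_gt0 k0.
pose Q u := (u ^ m.+2 <= d ^ 2)%N.
have exQ : exists u, Q u by exists 1%N; rewrite /Q exp1n expn_gt0; lia.
have Qub u : Q u -> (u <= d ^ 2)%N.
  apply: leq_trans; rewrite -[leqLHS]expn1.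
  by case: u => // u; rewrite leq_pexp2l.
case: (ex_maxnP exQ Qub) => u Qu umax.
have u0 : (0 < u)%N by apply: umax; rewrite /Q exp1n expn_gt0; lia.
(* As m + 2 >= 4, u^4 <= u^(m+2) <= d^2. *)
have ud : (u ^ 2 <= d)%N.
  rewrite -(leq_exp2r _ _ (isT : 0 < 2)%N) -expnM; apply: leq_trans Qu.
  by rewrite leq_pexp2l//; lia.
have ud4 : (4 * u <= d)%N.
  rewrite -(leq_exp2r _ _ (isT : 0 < 2)%N) expnMn.
  have : (d * 64 <= d ^ 2)%N by rewrite expnS expn1 leq_mul2l d64 orbT.
  move: ud; rewrite (_ : 4 ^ 2 = 16)%N//; lia.
have u4 : (0 < 4 * u)%N by rewrite muln_gt0.
have K0 : (0 < d %/ (4 * u))%N by rewrite divn_gt0.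
have dK : (d <= d %/ (4 * u) * (8 * u))%N.
  apply: ltnW; apply: leq_trans (ltn_ceil d u4) _.
  by rewrite (_ : 8 * u = 2 * (4 * u))%N ?mulnA ?leq_mul2r; lia.
exists u; split => //.
- have : ~~ Q u.+1 by apply/negP => /umax; rewrite ltnn.
  rewrite /Q -ltnNge => /ltnW/leq_trans; apply.
  by rewrite leq_exp2r//; lia.
(* From d <= 8uK and u^2 <= d one gets d^2 <= 64 K^2 d, hence 64 k^2 <= d <= 64 K^2. *)
- move: dK; set K := (d %/ _)%N => dK.
  rewrite -(leq_exp2r _ _ (isT : 0 < 2)%N) -(leq_pmul2l (isT : 0 < 64)%N).
  apply: leq_trans kd _.
  have d0 : (0 < d)%N by lia.
  rewrite -(leq_pmul2l d0) mulnn.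
  have : (d ^ 2 <= (K * (8 * u)) ^ 2)%N by rewrite leq_exp2r.
  rewrite !expnMn (_ : 8 ^ 2 = 64)%N// => /leq_trans; apply.
  by rewrite mulnCA [leqRHS]mulnCA leq_mul2l/= mulnC leq_mul2r ud orbT.
Qed.

Section rate_bounds.
Context {R : realType}.

(** Since m - 1 >= 2m/(m+2) for m >= 2, and log d >= 1, both terms of the rate are at most
    d^(-2m/(m+2)) log d. This power equals (d^2)^(2/(m+2)) / d^2, to which the bound on d^2
    applies. *)
Lemma rate_div_ln_le (m d u : nat) : (2 <= m)%N -> (0 < d)%N ->
  1 <= ln (d%:R : R) -> (d ^ 2 <= (2 * u) ^ m.+2)%N ->
  rate R m d / ln d%:R <= (2 * u)%N%:R ^+ 2 / d%:R ^+ 2.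
Proof.
move=> m2 d_gt0 lnd du.
have d0 : 0 < d%:R :> R by rewrite ltr0n.
have d1 : 1 <= d%:R :> R by rewrite ler1n.
have ln0 : 0 < ln (d%:R : R) by rewrite (lt_le_trans ltr01).
have m20 : 0 < m%:R + 2 :> R by rewrite ltr_wpDl.
have m2R : 2 <= m%:R :> R by rewrite ler_nat.
have A_le : (d%:R : R) `^ (- (2 * m%:R / (m%:R + 2))) <=
    (2 * u)%N%:R ^+ 2 / d%:R ^+ 2.
  have -> : - (2 * m%:R / (m%:R + 2)) = 2 * (2 / (m%:R + 2)) + - 2 :> R.
    by field; rewrite gt_eqF.
  rewrite powRD; last by rewrite (gt_eqF d0) implybT.
  rewrite powRN powR_mulrn ?ler0n// ler_pM2r ?invr_gt0 ?exprn_gt0//.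
  rewrite powRrM powR_mulrn ?ler0n//.
  have -> : (2 * u)%N%:R ^+ 2 =
      ((2 * u)%N%:R ^+ m.+2 : R) `^ (2 / (m%:R + 2)).
    rewrite -[in RHS]powR_mulrn ?ler0n// -powRrM.
    rewrite (_ : m.+2%:R * _ = 2) ?powR_mulrn ?ler0n//.
    by rewrite -addn2 natrD; field; rewrite gt_eqF.
  apply: ge0_ler_powR; rewrite ?nnegrE ?exprn_ge0 ?divr_ge0 ?ler0n//.
  by rewrite -!natrX ler_nat.
have B_le : d%:R ^- m.-1 <= (d%:R : R) `^ (- (2 * m%:R / (m%:R + 2))).
  rewrite -powR_mulrn ?ler0n// -powRN ler_powR//.
  rewrite lerN2 ler_pdivrMr// -subn1 natrB; last by lia.
  nra.
rewrite ler_pdivrMr// /rate ge_max; apply/andP; split.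
  apply: le_trans A_le _; rewrite ler_peMr// divr_ge0// exprn_ge0//.
by rewrite ler_pM2r//; exact: le_trans A_le.
Qed.

(** exp(1/16) <= 16/15 reduces the base on the left to 128/75 = 2 / (75/64), and Bernoulli gives
    (75/64)^N >= 1 + 600 * 11/64 > 100. *)
Lemma hamming_ball_small (N : nat) : (600 <= N)%N ->
  100 * expR (N%:R / 16) * (8 / 5) ^+ N < 2 ^+ N :> R.
Proof.
move=> N600.
have e_le : expR (16^-1 : R) <= 16 / 15.
  have := expR_ge1Dx (- 16^-1 : R); rewrite expRN => e15.
  have e0 : 0 < expR (16^-1 : R) by exact: expR_gt0.
  have : expR (16^-1 : R) * (1 - 16^-1) <= 1.
    by rewrite mulrC -ler_pdivlMr// div1r.
  lra.
have bernoulli n : 1 + n%:R * (11 / 64) <= (75 / 64 : R) ^+ n.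
  elim: n => [|n IH]; first by rewrite mul0r addr0 expr0.
  rewrite exprS -natr1; have : 0 <= n%:R :> R by []; nra.
have N6 : 600 <= N%:R :> R by rewrite ler_nat.
have N100 : 100 < (75 / 64 : R) ^+ N.
  by apply: lt_le_trans (bernoulli N); lra.
have -> : expR (N%:R / 16 : R) = expR 16^-1 ^+ N by rewrite -expRM_natl.
rewrite -mulrA -exprMn.
have : (expR 16^-1 * (8 / 5)) ^+ N <= (128 / 75 : R) ^+ N.
  by rewrite lerXn2r ?nnegrE ?mulr_ge0 ?expR_ge0//; lra.
have p0 : 0 < (128 / 75 : R) ^+ N by rewrite exprn_gt0//; lra.
have -> : (2 : R) ^+ N = (75 / 64) ^+ N * (128 / 75) ^+ N.
  by rewrite -exprMn; congr (_ ^+ _); field.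
nra.
Qed.

End rate_bounds.

(** * The minimax lower bound *)

Theorem theorem5 (R : realType) (m : nat) (L : R) (M : set ('rV[R]_m -> R))
    (hm : (2 <= m)%N) (hL : 0 < L)
    (hM : M = @isotonic_class R m \/ M = @lip_monotonic_class R m) :
  exists2 c : R, 0 < c &
    \forall d \near \oo,
      forall (d0 : measure_display) (Omega : measurableType d0)
        (P : probability Omega R) (E : m.-tuple 'I_d -> {RV P >-> R}),
        iid_std_normal E ->
        ((8 / 10)%:E <=
         minimax_prob E (@smooth_tensors R m L M d)
                      (c * (rate R m d / ln d%:R)))%E.
Proof.
(* Then a m + a = L, so any tent slope below [a] respects the Lipschitz constant. *)
pose a : R := L / (m%:R + 1).
have a0 : 0 < a by rewrite divr_gt0// ltr_wpDl.
(* The first bound keeps the ramp dominant; the second keeps the squared distance to the bare ramp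
   below N/16. *)
pose b : R := Num.min (a / 2) (8 ^- m.+1).
have b0 : 0 < b by rewrite lt_min divr_gt0//= invr_gt0 exprn_gt0.
have ba : b < a.
  by rewrite /b gt_min ltr_pdivrMr// ltr_pMr// ltr1n.
have abL : a * m%:R + b <= L.
  have -> : L = a * m%:R + a by rewrite /a; field; rewrite gt_eqF// ltr_wpDl.
  by rewrite lerD2l ltW.
have b8 : b <= 8 ^- m.+1 by rewrite /b ge_min lexx orbT.
(* Chosen so that, after the bounds on d^m and on the rate, the radius 4t becomes exactly the energy
   of N/8 differing blocks. *)
pose c : R := b ^+ 2 / (128 * 4 ^+ m).
exists c; first by rewrite divr_gt0 ?mulr_gt0 ?exprn_gt0.
near=> d => d0 Omega P E iidE.
(* This gives at least 600 blocks per side, hence the N >= 600 of [hamming_ball_small]. *)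
have kd : (64 * 600 ^ 2 <= d)%N by near: d; exact: nbhs_infty_ge.
have ed : expR 1 <= d%:R :> R by near: d; exact: nbhs_infty_ger.
have [u [u_gt0 ud du dK K600]] := block_scale m d 600 hm isT kd.
set K := (d %/ (4 * u))%N in dK K600.
have K_gt0 : (0 < K)%N by exact: leq_trans K600.
have Kd : (K * (4 * u) <= d)%N by exact: leq_trunc_div.
have d_gt0 : (0 < d)%N by apply: leq_trans Kd; rewrite !muln_gt0 u_gt0 K_gt0.
have lnd : 1 <= ln (d%:R : R).
  by rewrite -[leLHS]expRK ler_ln// posrE ?expR_gt0// ltr0n.
have rate_le := rate_div_ln_le m d u hm d_gt0 lnd du.
set rho := rate R m d / ln d%:R in rate_le *.
have dR : 0 < d%:R :> R by rewrite ltr0n.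
have uR : 0 < u%:R :> R by rewrite ltr0n.
have dm0 : 0 < d%:R ^+ m :> R by rewrite exprn_gt0.
have dmK : d%:R ^+ m <= K%:R ^+ m * (8 * u%:R) ^+ m :> R.
  rewrite -exprMn lerXn2r ?nnegrE ?mulr_ge0 ?ler0n//.
  by rewrite -!natrM ler_nat.
have -> : c * rho = (d%:R ^+ m)^-1 * (d%:R ^+ m * (c * rho)).
  by rewrite mulKf// gt_eqF.
pose N := #|{: mindex m K}|.
have NE : N = (K ^ m)%N by rewrite /N card_tuple card_ord.
have N600 : (600 <= N)%N.
  by rewrite NE (leq_trans K600)// -[leqLHS]expn1 leq_pexp2l// ltnW.
apply: (minimax_prob_ge P E _ {ffun mindex m K -> bool}
  (ramp_tensor d u K a b) (ramp_tensor d u K a b [ffun=> false])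
  _ (N%:R / 16) ((8 / 5) ^+ N)) => //.
- move=> s; have [n mE] : exists n, m = n.+1.
    by exists m.-1; rewrite prednK// ltnW.
  subst m.
  by apply: ramp_tensor_smooth => //; exact: ltW.
- move=> s; apply: le_trans (sumsq_ramp_tensor_le d u K a b s _) _.
  rewrite /radius NE natrX natrM.
  have x1 : 1 <= (8 : R) ^+ m by rewrite exprn_ege1// ler1n.
  have b16 : 4 * 8 ^+ m * b ^+ 2 <= 16^-1.
    have : b ^+ 2 <= (8 ^- m.+1) ^+ 2.
      by rewrite lerXn2r ?nnegrE ?invr_ge0 ?exprn_ge0// ltW.
    rewrite [8 ^+ m.+1]exprS invfM; move: (8 ^+ m) x1 => x x1 bx.
    have x0 : 0 < x by exact: lt_le_trans x1.
    apply: (@le_trans _ _ (4 * x * (8^-1 / x) ^+ 2)).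
      by rewrite ler_pM2l// mulr_gt0.
    rewrite (_ : 4 * x * _ = 16^-1 / x); last by field; rewrite gt_eqF.
    by rewrite ler_pdivrMr// ler_peMr.
  have uDle : u%:R ^+ m.+2 / d%:R ^+ 2 <= 1 :> R.
    by rewrite ler_pdivrMr ?exprn_gt0// mul1r -!natrX ler_nat.
  apply: (@le_trans _ _ (K%:R ^+ m * (8 * u%:R) ^+ m *
      (b * (2 * u%:R / d%:R)) ^+ 2)).
    by rewrite ler_wpM2r// sqr_ge0.
  have -> : K%:R ^+ m * (8 * u%:R) ^+ m * (b * (2 * u%:R / d%:R)) ^+ 2 =
      K%:R ^+ m * ((4 * 8 ^+ m * b ^+ 2) * (u%:R ^+ m.+2 / d%:R ^+ 2)).
    rewrite exprMn -(addn2 m) exprD; move: (8 ^+ m) (u%:R ^+ m) => x y.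
    by field; rewrite gt_eqF.
  rewrite ler_wpM2l ?exprn_ge0// -[leRHS]mulr1 ler_pM//.
  by rewrite !mulr_ge0// ?exprn_ge0// ltW.
(* Closeness bounds the energy [beta] times the Hamming distance by 4t, and 4t <= beta N / 8, so s
   lies in the Hamming ball of radius N/8. *)
- move=> s0; apply: le_trans (card_hamming_ball s0); rewrite ler_nat.
  apply: subset_leq_card; apply/fintype.subsetP => s; rewrite !inE => close.
  have := sumsq_ramp_tensor_ge d u K u_gt0 Kd a b s s0 => /le_trans/(_ close).
  set beta := (_ ^+ m * _); have beta0 : 0 < beta.
    by rewrite mulr_gt0 ?exprn_gt0 ?mulr_gt0 ?invr_gt0// ltr0n muln_gt0.
  have : 4 * (d%:R ^+ m * (c * rho)) <= beta * N%:R / 8.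
    apply: (@le_trans _ _ (4 * (K%:R ^+ m * (8 * u%:R) ^+ m *
        (c * ((2 * u)%N%:R ^+ 2 / d%:R ^+ 2))))).
      rewrite ler_pM2l//.
      have c0 : 0 < c by rewrite divr_gt0 ?mulr_gt0 ?exprn_gt0.
      apply: (@le_trans _ _ (d%:R ^+ m *
          (c * ((2 * u)%N%:R ^+ 2 / d%:R ^+ 2)))).
        by rewrite ler_pM2l// ler_pM2l.
      by rewrite ler_wpM2r// mulr_ge0 ?divr_ge0 ?exprn_ge0// ltW.
    rewrite /beta NE natrX natrM /c !exprMn.
    have -> : (8 : R) ^+ m = 2 ^+ m * 4 ^+ m by rewrite -exprMn -natrM.
    have y0 : 0 < (4 : R) ^+ m by rewrite exprn_gt0.
    move: (4 ^+ m) y0 => y y0; move: (2 ^+ m) (u%:R ^+ m) (K%:R ^+ m) => x z w.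
    by rewrite le_eqVlt; apply/orP; left; apply/eqP; field; rewrite !gt_eqF.
  move=> /[swap] /le_trans /[apply].
  rewrite ler_pdivlMr// mulrAC mulrC ler_pM2l// -natrM ler_nat.
  by rewrite mulnC.
- by rewrite card_ffun card_bool natrX; exact: hamming_ball_small.
Unshelve. all: by end_near. Qed.
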